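(* Let $S$ be a monoid and let $A$ be a right $S$-act such that $\mathrm{Rad}(A)\leq_s A$. The following statements are equivalent: (i) $A$ is a union of hollow subacts; (ii) every proper subact $B$ of $A$ such that the Rees factor act $A/B$ is finitely generated has a supplement in $A$; (iii) every maximal subact of $A$ has a supplement in $A$.
   Context: A right $S$-act over a monoid $S$ is a non-empty set $A$ with a unital associative right action of $S$. A subact of $A$ is a non-empty subset closed under the action; it is proper if it is not equal to $A$. A maximal subact is a proper subact not properly contained in any other proper subact. The Rees factor act $A/B$ is the quotient of $A$ identifying all elements of the subact $B$ to one point and nothing else. An act is finitely generated if it is a finite union of cyclic subacts $a_iS$. A subact $B$ of $A$ is superfluous in $A$, written $B\leq_s A$, if $B\cup C\neq A$ for every proper subact $C$ of $A$; an act is hollow if all its proper subacts are superfluous in it. $\mathrm{Rad}(A)$ is the intersection of all maximal subacts of $A$, with $\mathrm{Rad}(A)=A$ if $A$ has no maximal subact; this intersection may be empty, in which case $\mathrm{Rad}(A)\leq_s A$ is regarded as (vacuously) true. If $B$ is a proper subact of $A$, a subact $C$ of $A$ (possibly $C=A$) is a supplement of $B$ in $A$ if $B\cup C=A$ and whenever $D\subseteq C$ is a subact with $B\cup D=A$, then $D=C$. *)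

(* Defs.v *)
From HB Require Import structures.
From mathcomp Require Import all_boot generic_quotient.
From mathcomp Require Import boolp classical_sets.

Set Implicit Arguments.
Unset Strict Implicit.
Unset Printing Implicit Defensive.

Local Open Scope classical_set_scope.
Local Open Scope quotient_scope.

HB.mixin Record isRightAct (S : monoidType) A := {
  ract : A -> S -> A;
  ract1 : forall a, ract a 1%g = a;
  ractM : forall a (s t : S), ract a (s * t)%g = ract (ract a s) t;
  ract_neq0 : [set: A] !=set0
}.

#[short(type="ractType")]
HB.structure Definition RightAct (S : monoidType) :=
  {A of isRightAct S A & Choice A}.

Record subact (S : monoidType) (A : ractType S) := Subact {
  subact_set :> set A;
  subact_neq0 : subact_set !=set0;
  subact_ract : forall a (s : S), subact_set a -> subact_set (ract a s)
}.

Section Subacts.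
Variables (S : monoidType) (A : ractType S).

Lemma setT_ract a (s : S) : [set: A] a -> [set: A] (ract a s).
Proof. by []. Qed.

Definition full_subact : subact A := Subact (ract_neq0 (s := A)) setT_ract.

(* The subacts of a subact C, seen as an act in its own right, are exactly the
   subacts of A contained in C; hence notions about the act C (being
   superfluous in C, being hollow) are expressed inside the ambient act A, the
   act A itself being full_subact. *)
Definition proper_subact (B C : subact A) : Prop := B `<` C.

(* B ranges over arbitrary sets because Rad(A) may be empty; the empty set is
   superfluous in every C. *)
Definition superfluous (B : set A) (C : subact A) : Prop :=
  B `<=` C /\
  forall D : subact A, proper_subact D C -> B `|` D <> C.

Definition hollow (C : subact A) : Prop :=
  forall B : subact A, proper_subact B C -> superfluous B C.

Definition maximal_subact (M : subact A) : Prop :=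
  proper_subact M full_subact /\
  forall N : subact A, proper_subact N full_subact -> ~ proper_subact M N.

(* An intersection over the empty family is setT (bigcap_set0), so this is the
   whole of A when there is no maximal subact. *)
Definition Rad : set A := \bigcap_(M in maximal_subact) subact_set M.

Definition supplement (B C : subact A) : Prop :=
  B `|` C = [set: A] /\
  forall D : subact A, D `<=` C -> B `|` D = [set: A] -> D = C :> set A.

Definition union_of_hollow : Prop :=
  exists F : set (subact A),
    (forall H : subact A, F H -> hollow H) /\
    \bigcup_(H in F) subact_set H = [set: A].

Definition cyclic_set (a : A) : set A := range (fun s : S => ract a s).

Definition finitely_generated : Prop :=
  exists r : seq A, \bigcup_(a in [set` r]) cyclic_set a = [set: A].

End Subacts.

Arguments full_subact {S} A.
Arguments Rad {S} A.
Arguments union_of_hollow {S} A.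
Arguments finitely_generated {S} A.

Section ReesFactor.
Variables (S : monoidType) (A : ractType S) (B : subact A).

Definition rees_rel (x y : A) : bool := `[< x = y \/ (subact_set B x /\ subact_set B y) >].

Lemma rees_rel_refl : reflexive rees_rel.
Proof. by move=> x; apply/asboolP; left. Qed.

Lemma rees_rel_sym : symmetric rees_rel.
Proof.
by move=> x y; apply/asboolP/asboolP => -[->|[? ?]]; by [left | right].
Qed.

Lemma rees_rel_trans : transitive rees_rel.
Proof.
move=> y x z /asboolP xy /asboolP yz; apply/asboolP.
case: xy yz => [->//|[Bx By]] [<-|[_ Bz]]; by right.
Qed.

Canonical rees_equiv := EquivRel rees_rel rees_rel_refl rees_rel_sym
  rees_rel_trans.

Definition rees_factor : Type := {eq_quot rees_rel}.

HB.instance Definition _ := Choice.on rees_factor.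
HB.instance Definition _ := EqQuotient.on rees_factor.

(* Acts on a chosen representative; pi_ract shows that the choice is
   irrelevant. *)
Definition rees_ract (x : rees_factor) (s : S) : rees_factor :=
  \pi_rees_factor (ract (repr x) s).

Lemma pi_ract a (s : S) :
  rees_ract (\pi_rees_factor a) s = \pi_rees_factor (ract a s).
Proof.
rewrite /rees_ract; apply/eqmodP.
have /eqmodP/asboolP[->|[Br Ba]] :
    repr (\pi_rees_factor a) = a %[mod rees_factor] by rewrite reprK.
  exact: rees_rel_refl.
by apply/asboolP; right; split; apply: subact_ract.
Qed.

Lemma rees_ract1 x : rees_ract x 1%g = x.
Proof. by rewrite /rees_ract ract1 reprK. Qed.

Lemma rees_ractM x (s t : S) :
  rees_ract x (s * t)%g = rees_ract (rees_ract x s) t.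
Proof. by rewrite {1 3}/rees_ract pi_ract ractM. Qed.

Lemma rees_neq0 : [set: rees_factor] !=set0.
Proof. by have [a _] := ract_neq0 (s := A); exists (\pi_rees_factor a). Qed.

HB.instance Definition _ :=
  isRightAct.Build S rees_factor rees_ract1 rees_ractM rees_neq0.

End ReesFactor.

(* Main.v *)
(** If every point of [A] outside [B] lies in a hollow subact, the union of the
    hollow subacts not contained in [B] is a supplement of [B]: a hollow [H] is
    covered by its traces on [B] and on any [D] with [B `|` D = A], so one of
    the traces is all of [H]. Conversely, a supplement of a maximal subact [M]
    is hollow because all its proper subacts lie in [M]; since [M] and its
    supplement cover [A], a point in no hollow subact is in every maximal one.
    Hence the radical and the union of the hollow subacts cover [A], and the
    radical, being superfluous, can be dropped. *)
Require Import Defs.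
From HB Require Import structures.
From mathcomp Require Import all_boot generic_quotient.
From mathcomp Require Import boolp classical_sets.

Set Implicit Arguments.
Unset Strict Implicit.
Unset Printing Implicit Defensive.

Local Open Scope classical_set_scope.
Local Open Scope quotient_scope.

Section SubactOperations.
Variables (S : monoidType) (A : ractType S).
Implicit Types B C D H M : subact A.

Lemma bigcup_subact (F : set (subact A)) :
  \bigcup_(H in F) subact_set H !=set0 ->
  exists U : subact A, U = \bigcup_(H in F) subact_set H :> set A.
Proof.
move=> F0; have FS a (s : S) : (\bigcup_(H in F) subact_set H) a ->
    (\bigcup_(H in F) subact_set H) (ract a s).
  by case=> H FH Ha; exists H => //; apply: subact_ract.
by exists (Subact F0 FS).
Qed.

Lemma setU_subact B C : exists U : subact A, U = B `|` C :> set A.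
Proof.
have U0 : B `|` C !=set0 by have [b Bb] := subact_neq0 B; exists b; left.
have US a (s : S) : (B `|` C) a -> (B `|` C) (ract a s).
  by case=> ?; [left|right]; apply: subact_ract.
by exists (Subact U0 US).
Qed.

Lemma setI_subact B C : B `&` C !=set0 ->
  exists I : subact A, I = B `&` C :> set A.
Proof.
move=> I0; have IS a (s : S) : (B `&` C) a -> (B `&` C) (ract a s).
  by case=> ? ?; split; apply: subact_ract.
by exists (Subact I0 IS).
Qed.

Lemma cyclic_subact (a : A) : exists C : subact A, C = cyclic_set a :> set A.
Proof.
have C0 : cyclic_set a !=set0 by exists (ract a 1%g), 1%g.
have CS b (s : S) : cyclic_set a b -> cyclic_set a (ract b s).
  by case=> t _ <-; exists (t * s)%g => //; rewrite ractM.
by exists (Subact C0 CS).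
Qed.

Lemma proper_fullE B : proper_subact B (full_subact A) <-> B <> [set: A] :> set A.
Proof.
rewrite /proper_subact properEneq; split=> [[/eqP]|BT] //.
by split=> //; apply/eqP.
Qed.

Lemma hollow_subsetU H B D :
  hollow H -> H `<=` B `|` D -> H `<=` B \/ H `<=` D.
Proof.
move=> hH HBD; apply: contrapT => /not_orP[nHB nHD].
have [x [Hx nBx]] : exists x, subact_set H x /\ ~ subact_set B x.
  by move/existsNP: nHB => [x /not_implyP]; exists x.
have [y [Hy nDy]] : exists y, subact_set H y /\ ~ subact_set D y.
  by move/existsNP: nHD => [y /not_implyP]; exists y.
(* Subacts are non-empty, so the traces of [H] on [B] and [D] need points: [y] serves for [B] and
   [x] for [D], while [x] and [y] respectively also show these traces to be proper. *)
have [Dx By] : subact_set D x /\ subact_set B y by split; [case: (HBD x Hx)|case: (HBD y Hy)].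
have [I IE] : exists I : subact A, I = H `&` B :> set A.
  by apply: setI_subact; exists y.
have [J JE] : exists J : subact A, J = H `&` D :> set A.
  by apply: setI_subact; exists x.
have pI : proper_subact I H.
  by rewrite /proper_subact IE; split=> [z []//|/(_ _ Hx)[]].
have pJ : proper_subact J H.
  by rewrite /proper_subact JE; split=> [z []//|/(_ _ Hy)[]].
case: (hH I pI) => _ /(_ J pJ); apply.
by rewrite IE JE -setIUr; apply/setIidPl.
Qed.

Lemma union_of_hollow_supplement B : union_of_hollow A ->
  proper_subact B (full_subact A) -> exists C : subact A, supplement B C.
Proof.
move=> [F [hF FT]] [_ nTB].
(* Members of [F] inside [B] are left out: a competitor [D] need not contain them, which would spoil
   minimality. *)
pose G := [set H : subact A | F H /\ ~ H `<=` B].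
have FU x : subact_set B x \/ (\bigcup_(H in G) subact_set H) x.
  have [Bx|nBx] := pselect (subact_set B x); [by left|right].
  have [H FH Hx] : (\bigcup_(H in F) subact_set H) x by rewrite FT.
  by exists H => //; split=> // /(_ _ Hx).
(* The union is non-empty because a point outside the proper subact [B] must lie in it. *)
have [C CE] : exists C : subact A, C = \bigcup_(H in G) subact_set H :> set A.
  apply: bigcup_subact; move/existsNP: nTB => [x /not_implyP[_ nBx]].
  by exists x; case: (FU x).
exists C; split; first by rewrite CE -subTset => x _; apply: FU.
move=> D DC BDT; apply/seteqP; split=> //; rewrite CE => x [H [FH nHB] Hx].
have HBD : H `<=` B `|` D by rewrite BDT.
by case: (hollow_subsetU (hF H FH) HBD) => // /(_ _ Hx).
Qed.

(** Otherwise the union would be a proper subact strictly above [M]. *)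
Lemma maximal_subactU M B :
  maximal_subact M -> ~ B `<=` M -> M `|` B = [set: A].
Proof.
move=> [_ maxM] nBM; apply: contrapT => MBT.
have [U UE] := setU_subact M B.
apply: (maxM U); first by apply/proper_fullE; rewrite UE.
rewrite /proper_subact UE; split; first exact: subsetUl.
by move=> UM; apply: nBM => x Bx; apply: UM; right.
Qed.

(** Two generators suffice: the point to which [M] collapses, and the class of any [a] outside [M],
    since [M] and the cyclic subact of [a] cover [A]. Maximal subacts thus fall under condition
    (ii). *)
Lemma rees_factor_maximal_finitely_generated M :
  maximal_subact M -> finitely_generated (rees_factor M).
Proof.
move=> maxM; have [m Mm] := subact_neq0 M.
have [[_ /existsNP[a /not_implyP[_ nMa]]] _] := maxM.
have [C CE] := cyclic_subact a.
have MCT : M `|` C = [set: A].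
  apply: maximal_subactU => //; rewrite CE => /(_ a) CM; apply: nMa.
  by apply: CM; exists 1%g; rewrite ?ract1.
exists [:: \pi_(rees_factor M) m; \pi_(rees_factor M) a].
rewrite -subTset => x _; rewrite -(reprK x).
have : (M `|` C) (repr x) by rewrite MCT.
rewrite CE => -[Mx|[s _ <-]].
  exists (\pi_(rees_factor M) m); first by rewrite /= mem_head.
  exists 1%g => //; rewrite ract1; apply/eqmodP/asboolP; by right.
exists (\pi_(rees_factor M) a); first by rewrite /= !inE eqxx orbT.
by exists s => //; apply: pi_ract.
Qed.

Lemma supplement_maximal_hollow M C :
  maximal_subact M -> supplement M C -> hollow C.
Proof.
move=> maxM [MCT minC].
have sub_M B : proper_subact B C -> B `<=` M.
  (* If [B] is not inside [M], then [M] and [B] cover [A], and minimality of the supplement forces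
     [B = C]. *)
  move=> [BC nCB]; apply: contrapT => /(maximal_subactU maxM)/(minC B BC) BE.
  by apply: nCB; rewrite BE.
move=> B pB; split=> [|D pD BDC]; first by case: pB.
(* Both [B] and [D] lie in [M]; if they covered [C], then [M] would be all of [A]. *)
case: maxM => -[_ nTM] _; apply: nTM; rewrite /= -MCT -BDC.
by rewrite !subUset; split=> //; split; apply: sub_M.
Qed.

Lemma supplement_maximal_union_of_hollow :
  superfluous (Rad A) (full_subact A) ->
  (forall M, maximal_subact M -> exists C : subact A, supplement M C) ->
  union_of_hollow A.
Proof.
move=> [_ sRad] supp; exists [set H : subact A | hollow H]; split=> //.
set U := \bigcup_(H in _) _.
have RadU : Rad A `|` U = [set: A].
  rewrite -subTset => x _; have [Ux|nUx] := pselect (U x); [by right|left].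
  move=> M maxM; have [C MC] := supp M maxM.
  have : (M `|` C) x by rewrite MC.1.
  by case=> // Cx; case: nUx; exists C => //; apply: supplement_maximal_hollow MC.
have [/bigcup_subact[V VE]|/nonemptyPn U0] := pselect (U !=set0).
  apply: contrapT => UT; apply: (sRad V); last by rewrite VE.
  by apply/proper_fullE; rewrite VE.
have RadT : Rad A = [set: A] by rewrite -RadU U0 setU0.
have hT : hollow (full_subact A).
  by move=> B pB; case: (sRad B pB); rewrite RadT setTU.
by rewrite -subTset => x _; exists (full_subact A).
Qed.

End SubactOperations.

Theorem theorem5p6 (S : monoidType) (A : ractType S)
    (hRad : superfluous (Rad A) (full_subact A)) :
  (union_of_hollow A <->
   (forall B : subact A, proper_subact B (full_subact A) ->
      finitely_generated (rees_factor B) ->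
      exists C : subact A, supplement B C)) /\
  ((forall B : subact A, proper_subact B (full_subact A) ->
      finitely_generated (rees_factor B) ->
      exists C : subact A, supplement B C) <->
   (forall M : subact A, maximal_subact M ->
      exists C : subact A, supplement M C)).
Proof.
have i_ii : union_of_hollow A -> forall B : subact A,
    proper_subact B (full_subact A) -> finitely_generated (rees_factor B) ->
    exists C : subact A, supplement B C.
  by move=> hA B pB _; apply: union_of_hollow_supplement.
have ii_iii : (forall B : subact A, proper_subact B (full_subact A) ->
      finitely_generated (rees_factor B) ->
      exists C : subact A, supplement B C) ->
    forall M : subact A, maximal_subact M -> exists C : subact A, supplement M C.
  move=> supp M maxM; apply: supp; first by case: maxM.
  exact: rees_factor_maximal_finitely_generated.
have iii_i := supplement_maximal_union_of_hollow hRad.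
split; split=> h.
- exact: i_ii.
- exact/iii_i/ii_iii.
- exact: ii_iii.
- exact/i_ii/iii_i.
Qed.
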